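(* Let $A$ be a finitely generated associative $\mathbb{C}$-algebra with $M_N(A)=0$ for some $N$. Let $\pi:A\to A/M_2(A)$ be the quotient map, $\bar S\subset A/M_2(A)$ a multiplicative subset without zero divisors, and $S=\pi^{-1}(\bar S)$. Then for $k$ odd, $$[A,[A,S^{-1}M_k(A)]]\subset S^{-1}M_{k+2}(A)+M_{k+3}(A[S^{-1}]).$$
   Context: $L_1=A$, $L_k=[A,L_{k-1}]$, $M_k=AL_kA$. $S$ satisfies the Ore condition and $A[S^{-1}]$ is the Ore localization. $S^{-1}M_j(A)$ denotes the subspace of $A[S^{-1}]$ spanned by elements $s^{-1}m$ with $s\in S$, $m\in M_j(A)$, and $[A,[A,V]]$ denotes the span of $[a,[b,v]]$ with $a,b\in A$, $v\in V$. *)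

(* Defs.v *)
From HB Require Import structures.
From mathcomp Require Import all_boot all_order all_algebra.
From mathcomp Require Import complex Rstruct.
Set Implicit Arguments. Unset Strict Implicit. Unset Printing Implicit Defensive.
Import GRing.Theory.
Local Open Scope ring_scope.

Definition CC : fieldType := (Rdefinitions.R)[i].

Inductive cspan (V : lmodType CC) (P : V -> Prop) : V -> Prop :=
| cspan_gen x : P x -> cspan P x
| cspan0 : cspan P 0
| cspanD x y : cspan P x -> cspan P y -> cspan P (x + y)
| cspanZ (c : CC) x : cspan P x -> cspan P (c *: x).

Inductive in_subalg (A : algType CC) (g : seq A) : A -> Prop :=
| subalg_gen x : x \in g -> in_subalg g x
| subalg1 : in_subalg g 1
| subalgD x y : in_subalg g x -> in_subalg g y -> in_subalg g (x + y)
| subalgZ (c : CC) x : in_subalg g x -> in_subalg g (c *: x)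
| subalgM x y : in_subalg g x -> in_subalg g y -> in_subalg g (x * y).

Definition fin_gen (A : algType CC) : Prop :=
  exists g : seq A, forall x : A, in_subalg g x.

(* L_k(A): L_1 = A, L_k = [A, L_{k-1}] (the span of commutators [a,l]).
   Paper indexing (k >= 1); the unused index 0 is set to A as well. *)
Fixpoint Lser (A : algType CC) (k : nat) : A -> Prop :=
  match k with
  | 0 => fun _ => True
  | 1 => fun _ => True
  | k'.+1 => cspan (fun x => exists a l, Lser k' l /\ x = a * l - l * a)
  end.

Definition Mser (A : algType CC) (k : nat) : A -> Prop :=
  cspan (fun x => exists a l b, Lser k l /\ x = a * l * b).

Definition left_ring_of_fractions (A : algType CC) (S : A -> Prop)
    (Q : unitAlgType CC) (phi : {lrmorphism A -> Q}) : Prop :=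
  [/\ forall s, S s -> phi s \is a GRing.unit,
      forall q : Q, exists s a, S s /\ q = (phi s)^-1 * phi a
    & forall a, phi a = 0 <-> exists s, S s /\ s * a = 0].

Definition SinvM (A : algType CC) (S : A -> Prop)
    (Q : unitAlgType CC) (phi : {lrmorphism A -> Q}) (j : nat) : Q -> Prop :=
  cspan (fun x => exists s m, S s /\ Mser j m /\ x = (phi s)^-1 * phi m).

(* Main.v *)
(* Write [v = q l] with [q = s^-1 b] and [l] in L_k(A); it suffices to treat
   [f q = [c, [a, q l]]] modulo the left ideal J = S^-1 M_{k+2}(A) + M_{k+3}(Q).
   From s q = b one gets s [a, q] = [a, b] - [a, s] q, so multiplying f q by s
   replaces q by elements of A, at the cost of terms controlled by
   M_3 M_j <= M_{j+2}, M_2 M_j <= M_{j+1} for j odd, and the fact that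
   [c, x] [a, l] is antisymmetric in a, c, x modulo M_{k+2}. The second inclusion
   comes from [A, M_j] <= L_{j+1} for j odd (Bapat-Jordan); all these facts rest
   on a [b, x] + b [a, x] being in L_{j+1} for x in L_j. *)
Require Import Defs.
From HB Require Import structures.
From mathcomp Require Import all_boot all_order all_algebra.
From mathcomp Require Import complex Rstruct.
From Stdlib Require Ncring Ncring_tac.
Import GRing.Theory.
Local Open Scope ring_scope.

(** * Noncommutative ring normalization for complex algebras *)

#[local] Instance alg_Ncring_ops (A : algType CC) :
  @Ncring.Ring_ops A 0 1 +%R *%R (fun x y => x - y) -%R eq := {}.

#[local] Instance alg_Ncring (A : algType CC) :
  Ncring.Ring (Ro := alg_Ncring_ops A).
Proof.
constructor; rewrite /=.
- exact: RelationClasses.eq_equivalence.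
- by move=> ? ? /= -> ? ? ->.
- by move=> ? ? /= -> ? ? ->.
- by move=> ? ? /= -> ? ? ->.
- by move=> ? ? /= ->.
- exact: add0r.
- exact: addrC.
- exact: addrA.
- exact: mul1r.
- exact: mulr1.
- exact: mulrA.
- exact: mulrDl.
- by move=> x y z; exact: mulrDr.
- by [].
- exact: subrr.
Qed.

Ltac ncring := Ncring_tac.non_commutative_ring.

Local Notation "{[ x , y ]}" := (x * y - y * x) (at level 0, x, y at level 99).

(** * Subspaces as predicates, and linear maps on spans *)

Class subspace (V : lmodType CC) (T : V -> Prop) : Prop := Subspace {
  mem0 : T 0;
  memD : forall x y, T x -> T y -> T (x + y);
  memZ : forall (c : CC) x, T x -> T (c *: x) }.
Arguments memD {V T _ x y}.
Arguments memZ {V T _} c {x}.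

Lemma memN {V : lmodType CC} {T : V -> Prop} {hT : subspace V T} {x} :
  T x -> T (- x).
Proof. by rewrite -scaleN1r; apply: memZ. Qed.

Lemma memB {V : lmodType CC} {T : V -> Prop} {hT : subspace V T} {x y} :
  T x -> T y -> T (x - y).
Proof. by move=> hx hy; apply: memD => //; apply: memN. Qed.

Lemma mem_eq {V : lmodType CC} {T : V -> Prop} {x y} : T x -> y = x -> T y.
Proof. by move=> h ->. Qed.

Lemma mem_div3 {V : lmodType CC} {T : V -> Prop} {hT : subspace V T} {x} :
  T (x + x + x) -> T x.
Proof.
move=> h.
have n3 : (3%:R : CC) != 0.
  by rewrite (@Num.Theory.pnatr_eq0 (Rdefinitions.R)[i]%C).
suff -> : x = (3%:R : CC)^-1 *: (x + x + x) by apply: memZ.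
have -> : x + x + x = (3%:R : CC) *: x.
  by rewrite scaler_nat !mulrS mulr0n addr0 addrA.
by rewrite scalerA mulVf // scale1r.
Qed.

#[local] Instance cspan_subspace (V : lmodType CC) (P : V -> Prop) :
  subspace V (cspan P).
Proof. by split; [exact: cspan0 | exact: cspanD | exact: cspanZ]. Qed.

#[local] Instance Lser_subspace (A : algType CC) k : subspace A (@Lser A k).
Proof. by case: k => [|[|k]]; [split|split|exact: cspan_subspace]. Qed.

#[local] Instance Mser_subspace (A : algType CC) k : subspace A (@Mser A k).
Proof. exact: cspan_subspace. Qed.

Section Linearity.
Variables (U : lmodType CC) (A : algType CC).
Implicit Types f g : U -> A.

Lemma linear_mull a f : linear f -> linear (fun x => a * f x).
Proof. by move=> lf c x y; rewrite lf mulrDr scalerAr. Qed.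

Lemma linear_mulr a f : linear f -> linear (fun x => f x * a).
Proof. by move=> lf c x y; rewrite lf mulrDl scalerAl. Qed.

Lemma linear_add f g : linear f -> linear g -> linear (fun x => f x + g x).
Proof. by move=> lf lg c x y; rewrite lf lg scalerDr addrACA. Qed.

Lemma linear_opp f : linear f -> linear (fun x => - f x).
Proof. by move=> lf c x y; rewrite lf opprD scalerN. Qed.

Lemma linear_rmor (B : algType CC) (phi : {lrmorphism A -> B}) f :
  linear f -> linear (fun x => phi (f x)).
Proof. by move=> lf c x y; rewrite lf linearP. Qed.

End Linearity.

Lemma linear_self (V : lmodType CC) : linear (fun x : V => x).
Proof. by []. Qed.

Ltac lin := repeat first
  [ apply: linear_self | apply: linear_add | apply: linear_opp
  | apply: linear_mull | apply: linear_mulr | apply: linear_rmor ].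

Lemma cspan_linear (U V : lmodType CC) (P : U -> Prop) (T : V -> Prop)
    (f : U -> V) : subspace V T -> linear f -> (forall x, P x -> T (f x)) ->
  forall x, cspan P x -> T (f x).
Proof.
move=> hT lf hP x; elim=> {x} [|| x y _ hx _ hy | c x _ hx].
- exact: hP.
- have -> : f 0 = 0; last exact: mem0.
  by have := lf (-1) 0 0; rewrite scaler0 addr0 scaleN1r addNr.
- by have := lf 1 x y; rewrite !scale1r => ->; apply: memD.
- have := lf c x 0; have := lf (-1) 0 0.
  rewrite !scaler0 !addr0 scaleN1r addNr => -> ->.
  by rewrite addr0; apply: memZ.
Qed.

(** * Vanishing of alternating expressions that satisfy a Jacobi identity *)

Lemma alternating_jacobi4 (A : algType CC) (T : A -> Prop)
    (G : A -> A -> A -> A -> A) : subspace A T ->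
  (forall c b a d, T (G c b a d + G c a b d)) ->
  (forall c b a d, T (G c b a d + G c b d a)) ->
  (forall c b a d, T (G c b a d + G b a c d + G a c b d)) ->
  forall c b a d, T (G c b a d).
Proof.
move=> hT s1 s2 jac c b a d.
have s3 x p q r : T (G x p q r + G x r q p).
  by apply: (mem_eq (memD (memB (s2 x p q r) (s1 x p r q)) (s2 x r p q))); ncring.
(* Modulo [T], [G] alternates in its last three arguments, so up to sign only the first one matters.
   [jac] with each of the four elements in last place relates the four values, and
   [jac + ka + kb - 2 kc] is [3 G c b a d]. *)
have ka : T (G c b a d + G b a c d - G d c b a).
  by apply: (mem_eq (memB (memD (s2 c b a d) (s3 b a c d)) (jac c b d a))); ncring.
have kb : T (G c b a d + G a c b d - G d c b a).
  apply: (mem_eq (memB (memD (memD (s3 c b a d) (s2 a c b d))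
    (memB (s1 d a c b) (s2 d c a b))) (jac c d a b))).
  by ncring.
have kc : T (G b a c d + G a c b d - G d c b a).
  apply: (mem_eq (memB (memD (memD (s2 b a c d) (s3 a c b d))
    (memB (s2 d b a c) (s1 d b c a))) (jac d b a c))).
  by ncring.
apply: mem_div3.
apply: (mem_eq (memB (memB (memD (memD (jac c b a d) ka) kb) kc) kc)).
by ncring.
Qed.

(** [twist] carries [s12] to antisymmetry in positions 1 and 5, hence to [s35]. With [s45], [W]
    alternates in its last three arguments, so the three terms of [jac] agree modulo [T]. *)
Lemma alternating_jacobi5 (A : algType CC) (T : A -> Prop)
    (W : A -> A -> A -> A -> A -> A) : subspace A T ->
  (forall c d e f z, T (W c d e f z + W d c e f z)) ->
  (forall c d e f z, T (W c d e f z + W c e d f z)) ->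
  (forall c d e f z, T (W c d e f z + W c d e z f)) ->
  (forall c d e f z, T (W c d e f z - W c z f e d)) ->
  (forall c d e f z, T (W c d e f z + W c d f z e + W c d z e f)) ->
  forall c d e f z, T (W c d e f z).
Proof.
move=> hT s12 s23 s45 twist jac c d e f z.
have s15 a1 a2 a3 a4 a5 : T (W a1 a2 a3 a4 a5 + W a5 a2 a3 a4 a1).
  apply: (mem_eq (memD (memD (twist a1 a2 a3 a4 a5) (s12 a1 a5 a4 a3 a2))
    (memN (twist a5 a1 a4 a3 a2)))); ncring.
have s13 a1 a2 a3 a4 a5 : T (W a1 a2 a3 a4 a5 + W a3 a2 a1 a4 a5).
  apply: (mem_eq (memD (memB (s12 a1 a2 a3 a4 a5) (s23 a2 a1 a3 a4 a5))
    (s12 a2 a3 a1 a4 a5))).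
  by ncring.
have s35 a1 a2 a3 a4 a5 : T (W a1 a2 a3 a4 a5 + W a1 a2 a5 a4 a3).
  apply: (mem_eq (memD (memB (s13 a1 a2 a3 a4 a5) (s15 a3 a2 a1 a4 a5))
    (s13 a5 a2 a1 a4 a3))).
  by ncring.
have r1 := @memB _ _ hT _ _ (s35 c d f z e) (s45 c d e f z).
have r2 := @memB _ _ hT _ _ (s35 c d z e f) (s45 c d f z e).
apply: mem_div3.
by apply: (mem_eq (memB (memB (memB (jac c d e f z) r1) r1) r2)); ncring.
Qed.

(** * Products and brackets in the lower central series *)

Section LowerCentralSeries.
Variable A : algType CC.
Implicit Types (a b c d e f m p q x y z : A) (i j k : nat).
Local Notation L := (@Lser A).
Local Notation M := (@Mser A).

Lemma Lser_comm k a x : L k.+1 x -> L k.+2 {[a, x]}.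
Proof. by move=> hx; apply: cspan_gen; exists a, x. Qed.

Lemma Lser_commr k a x : L k.+1 x -> L k.+2 {[x, a]}.
Proof. by move=> hx; apply: (mem_eq (memN (Lser_comm _ a _ hx))); rewrite opprB. Qed.

Lemma Lser_elim k (V : lmodType CC) (T : V -> Prop) (g : A -> V) :
  subspace V T -> linear g -> (forall a l, L k.+1 l -> T (g {[a, l]})) ->
  forall x, L k.+2 x -> T (g x).
Proof.
move=> hT lg h; apply: cspan_linear => // _ [a [l [hl ->]]]; exact: h.
Qed.

Lemma Lser_decr k x : L k.+2 x -> L k.+1 x.
Proof.
elim: k x => [//|k IH] x.
apply: (Lser_elim _ _ _ (fun x => x)) => // a l hl.
by apply: Lser_comm; apply: IH.
Qed.

(** Left multiples [a l] already span [M k.+1]: [a l b = a b l - a [b, l]], and [[b, l]] is again in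
    [L k.+1]. *)
Lemma Mser_elim k (V : lmodType CC) (T : V -> Prop) (g : A -> V) :
  subspace V T -> linear g -> (forall a l, L k.+1 l -> T (g (a * l))) ->
  forall x, M k.+1 x -> T (g x).
Proof.
move=> hT lg h; apply: cspan_linear => // _ [a [l [b [hl ->]]]].
have -> : a * l * b = -1 *: (a * {[b, l]}) + a * b * l by rewrite scaleN1r; ncring.
rewrite lg; apply: memD; last exact: h.
by apply: memZ; apply: h; apply: Lser_decr; apply: Lser_comm.
Qed.

Lemma Lser_Mser k x : L k x -> M k x.
Proof. by move=> hx; apply: cspan_gen; exists 1, x, 1; rewrite mul1r mulr1. Qed.

Lemma Mser_mull k a x : M k x -> M k (a * x).
Proof.
apply: (cspan_linear _ _ _ _ (fun x => a * x)); first by lin.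
move=> _ [p [l [b [hl ->]]]]; apply: cspan_gen; exists (a * p), l, b.
by rewrite !mulrA.
Qed.

Lemma Mser_mulr k a x : M k x -> M k (x * a).
Proof.
apply: (cspan_linear _ _ _ _ (fun x => x * a)); first by lin.
move=> _ [p [l [b [hl ->]]]]; apply: cspan_gen; exists p, l, (b * a).
by rewrite !mulrA.
Qed.

Lemma Mser_decr k x : M k.+2 x -> M k.+1 x.
Proof.
apply: (Mser_elim _ _ _ (fun x => x)) => // a l hl.
by apply: Mser_mull; apply: Lser_Mser; apply: Lser_decr.
Qed.

Lemma Mser_comm k a x : M k.+1 x -> M k.+1 {[a, x]}.
Proof. by move=> hx; apply: memB; [apply: Mser_mull|apply: Mser_mulr]. Qed.

Lemma Lser_bracket i j x y : L i.+1 x -> L j.+1 y -> L (i + j).+2 {[x, y]}.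
Proof.
elim: i x j y => [x j y _ hy|i IH x j y hx hy]; first by rewrite add0n; apply: Lser_comm.
move: x hx; apply: (Lser_elim _ _ _ (fun x => {[x, y]})); first by lin.
move=> a l hl.
have h1 := IH _ _ _ hl (Lser_comm _ a _ hy).
have h2 := Lser_comm _ a _ (IH _ _ _ hl hy).
rewrite addnS in h1.
by apply: (mem_eq (memB h2 h1)); ncring.
Qed.

(** The expression equals [[a b, x] + [b, [a, x]]]. *)
Lemma Lser_mul_comm_sym k a b x :
  L k.+1 x -> L k.+2 (a * {[b, x]} + b * {[a, x]}).
Proof.
move=> hx; have h1 := Lser_comm _ (a * b) _ hx.
have h2 := Lser_comm _ b _ (Lser_decr _ _ (Lser_comm _ a _ hx)).
by apply: (mem_eq (memD h1 h2)); ncring.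
Qed.

(** Bracket [Lser_mul_comm_sym] with [c]; the Leibniz terms [a [c, [b, x]]] and [b [c, [a, x]]] lie
    in [M k.+3]. *)
Lemma comm_mul_comm_sym k a b c x :
  L k.+1 x -> M k.+3 ({[c, a]} * {[b, x]} + {[c, b]} * {[a, x]}).
Proof.
move=> hx; have h := Lser_Mser _ _ (Lser_comm _ c _ (Lser_mul_comm_sym _ a b _ hx)).
have ha y := Mser_mull _ y _ (Lser_Mser _ _ (Lser_comm _ c _ (Lser_comm _ a _ hx))).
have hb y := Mser_mull _ y _ (Lser_Mser _ _ (Lser_comm _ c _ (Lser_comm _ b _ hx))).
by apply: (mem_eq (memB (memB h (ha b)) (hb a))); ncring.
Qed.

Lemma comm3_mul_comm_sym k a b c d y : L k.+1 y ->
  M k.+4 ({[c, {[b, a]}]} * {[d, y]} + {[c, {[b, d]}]} * {[a, y]}).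
Proof.
move=> hy.
(* Expand [[c, [b, a [d, y] + d [a, y]]]] by Leibniz; [h1] and [h2] remove the mixed terms, in which
   [b] and [c] act on different factors. *)
have h := Lser_Mser _ _ (Lser_comm _ c _ (Lser_comm _ b _
  (Lser_mul_comm_sym _ a d _ hy))).
have h4 p q := Mser_mull _ p _ (Lser_Mser _ _ (Lser_comm _ c _
  (Lser_comm _ b _ (Lser_comm _ q _ hy)))).
have h1 := comm_mul_comm_sym _ b c a _ (Lser_comm _ d _ hy).
have h2 := comm_mul_comm_sym _ b c d _ (Lser_comm _ a _ hy).
apply: (mem_eq (memB (memD (memD h h1) h2) (memD (h4 a d) (h4 d a)))); ncring.
Qed.

(* As a function of b, a, d the product is alternating modulo M k.+4; together
   with the Jacobi identity for c, b, a this makes 3 times the product vanish. *)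
Lemma comm3_mul_comm k a b c d y : L k.+1 y ->
  M k.+4 ({[c, {[b, a]}]} * {[d, y]}).
Proof.
move=> hy; pose G c b a d := {[c, {[b, a]}]} * {[d, y]}.
apply: (alternating_jacobi4 _ _ G) => {}c {}b {}a {}d.
- by apply: (mem_eq mem0); rewrite /G; ncring.
- exact: comm3_mul_comm_sym.
- by apply: (mem_eq mem0); rewrite /G; ncring.
Qed.


Lemma Lser3_mul_comm k m d y : L 3 m -> L k.+1 y -> M k.+4 (m * {[d, y]}).
Proof.
move=> hm hy; move: m hm.
apply: (Lser_elim _ _ _ (fun m => m * {[d, y]})); first by lin.
move=> c u hu; move: u hu.
apply: (Lser_elim _ _ _ (fun u => {[c, u]} * {[d, y]})); first by lin.
move=> b a _; exact: comm3_mul_comm.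
Qed.

Lemma Lser3_mul_Lser k m x : L 3 m -> L k.+1 x -> M k.+3 (m * x).
Proof.
case: k => [|k] hm; first by move=> _; apply: Mser_mulr; apply: Lser_Mser.
move: x; apply: (Lser_elim _ _ _ (fun x => m * x)); first by lin.
by move=> a l hl; apply: Lser3_mul_comm.
Qed.

Lemma Mser3_mul k m x : M 3 m -> M k.+1 x -> M k.+3 (m * x).
Proof.
move=> hm hx; move: m hm.
apply: (Mser_elim _ _ _ (fun m => m * x)); first by lin.
move=> p m hm; rewrite -mulrA; apply: Mser_mull; move: x hx.
apply: (Mser_elim _ _ _ (fun x => m * x)); first by lin.
move=> q l hl.
(* Move [q] to the right: [m q l = m l q + m [q, l]]. *)
have h1 := Mser_mulr _ q _ (Lser3_mul_Lser _ _ _ hm hl).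
have h2 := Lser3_mul_Lser _ _ _ hm (Lser_comm _ q _ hl).
by apply: (mem_eq (memD h1 (Mser_decr _ _ h2))); ncring.
Qed.

(** * Commutators with [M j] for odd [j] *)

Lemma comm_mul_swap k c d x : L k.+1 x ->
  L k.+2 ({[c, d * x]} + {[d, c * x]}).
Proof. by move=> /(Lser_mul_comm_sym _ d c) h; apply: (mem_eq h); ncring. Qed.

Lemma comm_comm_mul_swap k b c d x : L k.+1 x ->
  L k.+3 ({[b, {[c, d * x]}]} + {[b, {[d, c * x]}]}).
Proof.
move=> /(comm_mul_swap _ c d)/(Lser_comm _ b) h.
by apply: (mem_eq h); ncring.
Qed.

Lemma comm_comm_mul_comm_swap k b c d e z : L k.+1 z ->
  L k.+4 ({[b, {[c, d * {[e, z]}]}]} + {[b, {[c, e * {[d, z]}]}]}).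
Proof.
move=> /(Lser_mul_comm_sym _ d e)/(Lser_comm _ c)/(Lser_comm _ b) h.
by apply: (mem_eq h); ncring.
Qed.

Lemma comm_mul_comm3 c d e f z : L 4 {[c, d * {[e, {[f, z]}]}]}.
Proof.
pose X b c d e z := {[b, {[c, d * {[e, z]}]}]}.
pose V b c d e z := {[b, {[c, d]} * {[e, z]}]}.
have L1 (x : A) : L 1 x by [].
have X23 a1 a2 a3 a4 a5 : L 4 (X a1 a2 a3 a4 a5 + X a1 a3 a2 a4 a5).
  by apply: comm_comm_mul_swap; apply: Lser_comm.
have X34 a1 a2 a3 a4 a5 : L 4 (X a1 a2 a3 a4 a5 + X a1 a2 a4 a3 a5).
  exact: comm_comm_mul_comm_swap.
have X45 a1 a2 a3 a4 a5 : L 4 (X a1 a2 a3 a4 a5 + X a1 a2 a3 a5 a4).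
  by apply: (mem_eq mem0); rewrite /X; ncring.
have Vswap a1 a2 a3 a4 a5 : L 4 (V a1 a2 a3 a4 a5 - V a1 a4 a5 a2 a3).
  have h := Lser_comm _ a1 _ (Lser_comm _ {[a2, a3]} _ (Lser_comm _ a4 _ (L1 a5))).
  by apply: (mem_eq h); rewrite /V; ncring.
apply: (alternating_jacobi5 _ _ (fun c d e f z => {[c, d * {[e, {[f, z]}]}]}))
  => {}c {}d {}e {}f {}z.
- apply: (mem_eq (comm_mul_swap _ c d _ (Lser_comm _ e _ (Lser_comm _ f _ (L1 z))))).
  by ncring.
- have h := Lser_comm _ c _ (Lser_mul_comm_sym _ d e _ (Lser_comm _ f _ (L1 z))).
  by apply: (mem_eq h); ncring.
- by apply: (mem_eq mem0); ncring.
(* By Leibniz, [[c, d [e, [f, z]]]] is [X c e d f z - V c e d f z]. Exchanging the pairs [(e, d)]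
   and [(f, z)] is an even permutation, so it preserves [X], which alternates in its last four
   arguments modulo [L 4]; [Vswap] handles [V]. *)
- have XX : L 4 (X c e d f z - X c f z e d).
    apply: (mem_eq (memB (memD (memB (X34 c e d f z) (X23 c e f d z))
      (X45 c f e d z)) (X34 c f e z d))).
    by ncring.
  by apply: (mem_eq (memB XX (Vswap c e d f z))); rewrite /X /V; ncring.
- by apply: (mem_eq mem0); ncring.
Qed.

(** The case [j = 3] is proved directly because the induction step of [comm_Mser_odd] relies on
    it. *)
Lemma comm_Mser3 c m : M 3 m -> L 4 {[c, m]}.
Proof.
apply: (Mser_elim _ _ _ (fun m => {[c, m]})); first by lin.
move=> d; apply: (Lser_elim _ _ _ (fun m => {[c, d * m]})); first by lin.
move=> e u hu; move: u hu.
apply: (Lser_elim _ _ _ (fun u => {[c, d * {[e, u]}]})); first by lin.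
move=> f z _; exact: comm_mul_comm3.
Qed.

(** Induction on [j] with the Jacobi identity [[m, [a, l]] = [a, [m, l]] - [[a, m], l]]. *)
Lemma Mser_Lser_bracket i j :
  (forall a m, M i.+1 m -> L i.+2 {[a, m]}) ->
  forall m l, M i.+1 m -> L j.+1 l -> L (i + j).+2 {[m, l]}.
Proof.
move=> h; elim: j => [|j IH] m l hm hl.
  by rewrite addn0; apply: (mem_eq (memN (h l _ hm))); rewrite opprB.
move: l hl; apply: (Lser_elim _ _ _ (fun l => {[m, l]})); first by lin.
move=> a l hl.
have h1 := Lser_bracket _ _ _ _ (h a _ hm) hl.
have h2 := Lser_comm _ a _ (IH _ _ hm hl).
by rewrite addnS; apply: (mem_eq (memB h2 h1)); ncring.
Qed.

(* Bapat-Jordan: [A, M_j] lies in L_{j+1} for j odd. In the step from j to j+2,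
   z is in L_j, so [f, d z] is in L_{j+1}; expand [c, [e, [f, d z]]] by the
   Leibniz rule. Modulo L_{j+3}, the terms X are alternating and cancel, and
   what is left is [c, d [f, [e, z]]]. *)
Lemma comm_Mser_odd n a m : M n.*2.+1 m -> L n.*2.+2 {[a, m]}.
Proof.
elim: n a m => [|n IH] a m; first by move=> _; apply: Lser_comm.
rewrite doubleS; move: m.
apply: (Mser_elim _ _ _ (fun m => {[a, m]})); first by lin.
move: a => c d x hx; move: x hx.
apply: (Lser_elim _ _ _ (fun x => {[c, d * x]})); first by lin.
move=> f u hu; move: u hu.
apply: (Lser_elim _ _ _ (fun u => {[c, d * {[f, u]}]})); first by lin.
move=> e z hz; set j := n.*2 in IH hz *.
have M1 x : M j.+1 (z * x) by apply: Mser_mulr; apply: Lser_Mser.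
have hK : L j.+4 {[c, {[e, {[f, d * z]}]}]}.
  apply: Lser_comm; apply: Lser_comm; apply: IH.
  by apply: Mser_mull; apply: Lser_Mser.
pose m := {[e, {[f, d]}]}.
have hm : L 3 m by do 2!apply: Lser_comm.
(* Uses [[c, m z] = [z c, m] + [c m, z]]: the first bracket falls under [IH], the second under
   [comm_Mser3]. *)
have hmz : L j.+4 {[c, m * z]}.
  have h1 := Mser_Lser_bracket _ 2 IH _ _ (M1 c) hm.
  have h2 := Mser_Lser_bracket 2 _ comm_Mser3 _ _ (Mser_mull _ c _ (Lser_Mser _ _ hm)) hz.
  rewrite addn2 in h1; rewrite add2n in h2.
  by apply: (mem_eq (memD h1 h2)); ncring.
pose X b c d e := {[b, {[c, d * {[e, z]}]}]}.
have hX : L j.+4 (X c f d e + X c e d f).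
  have s1 := comm_comm_mul_swap _ c f d _ (Lser_comm _ e _ hz).
  have s2 := comm_comm_mul_comm_swap _ c d f e _ hz.
  have s3 := comm_comm_mul_swap _ c d e _ (Lser_comm _ f _ hz).
  by apply: (mem_eq (memD (memB s1 s2) s3)); rewrite /X; ncring.
apply: (mem_eq (memD hmz (memB hX hK))); rewrite /m /X; ncring.
Qed.

(** In [[c, d] x = [c, d x] - d [c, x]] both brackets are commutators with elements of an [M] of odd
    index. *)
Lemma Mser2_mul_odd n m x : M 2 m -> M n.*2.+1 x -> M n.*2.+2 (m * x).
Proof.
move=> hm hx; move: m hm.
apply: (Mser_elim _ _ _ (fun m => m * x)); first by lin.
move=> p u hu; rewrite -mulrA; apply: Mser_mull; move: u hu.
apply: (Lser_elim _ _ _ (fun u => u * x)); first by lin.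
move=> c d _.
have h1 := Lser_Mser _ _ (comm_Mser_odd _ c _ (Mser_mull _ d _ hx)).
have h2 := Mser_mull _ d _ (Lser_Mser _ _ (comm_Mser_odd _ c _ hx)).
by apply: (mem_eq (memB h1 h2)); ncring.
Qed.

End LowerCentralSeries.

(** * Passage to the Ore localization *)

Section OreLocalization.
Variables (A : algType CC) (S : A -> Prop) (Q : unitAlgType CC).
Variable phi : {lrmorphism A -> Q}.
Hypothesis hQ : left_ring_of_fractions S phi.

Lemma Lser_rmor k x : Lser k x -> Lser k (phi x).
Proof.
case: k => [//|k]; elim: k x => [//|k IH] x.
apply: (Lser_elim _ _ _ _ (fun x => phi x)); first by lin.
by move=> a l /IH hl; rewrite rmorphB !rmorphM; apply: Lser_comm.
Qed.

Lemma Mser_rmor k x : Mser k x -> Mser k (phi x).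
Proof.
apply: (cspan_linear _ _ _ _ (fun x => phi x)); first by lin.
move=> _ [a [l [b [/Lser_rmor hl ->]]]].
by rewrite !rmorphM; apply: cspan_gen; exists (phi a), (phi l), (phi b).
Qed.

(** The numerator of a left fraction [q] is absorbed by the ideal [M j]; this makes [SinvM] a left
    ideal of [Q]. *)
Lemma SinvM_mul_rmor j q m : Mser j m -> SinvM S phi j (q * phi m).
Proof.
move=> hm; case: hQ => _ /(_ q) [s [a [hs ->]]] _.
apply: cspan_gen; exists s, (a * m); split=> //; split; first exact: Mser_mull.
by rewrite rmorphM mulrA.
Qed.

Lemma SinvM_mull j q x : SinvM S phi j x -> SinvM S phi j (q * x).
Proof.
apply: (cspan_linear _ _ _ _ (fun x => q * x)); first by lin.
by move=> _ [s [m [_ [hm ->]]]]; rewrite mulrA; apply: SinvM_mul_rmor.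
Qed.

(* Restated so that [phi] keeps its coercion from [lrmorphism] after rewriting. *)
Let phiD x y : phi (x + y) = phi x + phi y. Proof. exact: rmorphD. Qed.
Let phiB x y : phi (x - y) = phi x - phi y. Proof. exact: rmorphB. Qed.
Let phiM x y : phi (x * y) = phi x * phi y. Proof. exact: rmorphM. Qed.

Variable n : nat.

(** For [k = 2n + 1] the two indices are [k + 2] and [k + 3]. *)
Definition SinvM_add_Mser (x : Q) : Prop :=
  exists u w : Q, SinvM S phi n.*2.+3 u /\ Mser n.*2.+4 w /\ x = u + w.
Local Notation J := SinvM_add_Mser.

#[local] Instance J_subspace : subspace Q J.
Proof.
split=> [|x y|c x].
- by exists 0, 0; rewrite addr0; split; [exact: cspan0 | split; first exact: mem0].
- move=> [u [w [hu [hw ->]]]] [u' [w' [hu' [hw' ->]]]]; exists (u + u'), (w + w').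
  by split; [exact: cspanD | split; [exact: memD | rewrite addrACA]].
- move=> [u [w [hu [hw ->]]]]; exists (c *: u), (c *: w).
  by split; [exact: cspanZ | split; [exact: memZ | rewrite scalerDr]].
Qed.

Lemma J_Mser w : Mser n.*2.+4 w -> J w.
Proof. by move=> hw; exists 0, w; rewrite add0r; split; first exact: cspan0. Qed.

Lemma J_mull q x : J x -> J (q * x).
Proof.
move=> [u [w [hu [hw ->]]]]; exists (q * u), (q * w).
by split; [exact: SinvM_mull | split; [exact: Mser_mull | rewrite mulrDr]].
Qed.

Lemma J_unit s x : S s -> J (phi s * x) -> J x.
Proof.
move=> hs hx; rewrite -(mulKr (_ : phi s \is a GRing.unit) x).
  exact: J_mull.
by case: hQ => /(_ s hs).
Qed.

Lemma J_mul_rmor q m : Mser n.*2.+3 m -> J (q * phi m).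
Proof.
move=> hm; exists (q * phi m), 0; rewrite addr0.
by split; [exact: SinvM_mul_rmor | split; first exact: mem0].
Qed.

(** The index [2n + 3] is odd, so [[q, phi m]] lies in [L] of index [2n + 4] over [Q], and [q] may
    change sides. *)
Lemma J_rmor_mul q m : Mser n.*2.+3 m -> J (phi m * q).
Proof.
move=> hm; have h1 := J_mul_rmor q _ hm.
have := comm_Mser_odd _ n.+1 q _ (Mser_rmor _ _ hm).
rewrite doubleS => /Lser_Mser/J_Mser h2.
by apply: (mem_eq (memB h1 h2)); ncring.
Qed.

(** * Clearing the denominator of [q] modulo [J] *)

Section FixedElements.
Variables (s b l : A) (q : Q).
Hypotheses (hs : S s) (hl : Lser n.*2.+1 l) (hq : phi s * q = phi b).

Let hlQ : Mser n.*2.+1 (phi l).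
Proof. by apply: Lser_Mser; apply: Lser_rmor. Qed.

Lemma J_comm_mul_comm_sym a c :
  J ({[phi a, q]} * {[phi c, phi l]} + {[phi c, q]} * {[phi a, phi l]}).
Proof.
apply: (J_unit _ _ hs).
have P (x : A) : Mser n.*2.+3
    ({[a, x]} * {[c, l]} + {[c, x]} * {[a, l]}).
  by apply: (mem_eq (memN (comm_mul_comm_sym _ _ a c x _ hl))); ncring.
have hb := J_mul_rmor 1 _ (P b).
have hsq := J_rmor_mul q _ (P s).
(* The cost of moving [q] to the right of [[y, l]], a product of type [M_2 M_{2n+3}]. *)
have hd (x y : A) : J ({[phi x, phi s]} * {[q, {[phi y, phi l]}]}).
  apply: J_Mser; apply: (Mser2_mul_odd _ n.+1); apply: Lser_Mser.
    exact: Lser_comm.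
  by do 2!apply: Lser_comm; apply: Lser_rmor.
move: hb hsq; rewrite !(phiB, phiD, phiM) -hq => hb hsq.
by apply: (mem_eq (memB (memB (memB hb hsq) (hd a c)) (hd c a))); ncring.
Qed.

(** In [m q l = m l q + m [q, l]], [M_3 M_j <= M_{j+2}] applies over [A] to [m l] and over [Q] to [m
    [q, l]]. *)
Lemma J_Mser3_mul m : Mser 3 m -> J (phi m * (q * phi l)).
Proof.
move=> hm.
have h1 := J_rmor_mul q _ (Mser3_mul _ _ _ _ hm (Lser_Mser _ _ _ hl)).
have h2 := J_Mser _ (Mser3_mul _ _ _ _ (Mser_rmor _ _ hm)
  (Lser_Mser _ _ _ (Lser_comm _ _ q _ (Lser_rmor _ _ hl)))).
by move: h1; rewrite phiM => h1; apply: (mem_eq (memD h1 h2)); ncring.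
Qed.

(** These are the mixed Leibniz terms of [[c, [a, s q]] l], needed in [J_comm3_mul]. *)
Lemma J_comm_comm_sym_mul a c :
  J (({[phi c, phi s]} * {[phi a, q]} + {[phi a, phi s]} * {[phi c, q]}) * phi l).
Proof.
apply: (J_unit _ _ hs).
have P (x : A) : Mser 3 ({[c, s]} * {[a, x]} + {[a, s]} * {[c, x]}).
  have h := @comm_mul_comm_sym _ 0 c a s x I.
  by apply: (mem_eq (memN h)); ncring.
have hb := J_mul_rmor 1 _ (Mser3_mul _ _ _ _ (P b) (Lser_Mser _ _ _ hl)).
have hsq := J_Mser3_mul _ (P s).
(* The cost of moving the new factor [s] past [[x, s]] to reach [[y, q]]: a product of type
   [M_3 M_{2n+2}]. *)
have hd (x y : A) : J ({[phi s, {[phi x, phi s]}]} * ({[phi y, q]} * phi l)).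
  apply: J_Mser; apply: Mser3_mul.
    by apply: Lser_Mser; do 2!apply: Lser_comm.
  by apply: Mser2_mul_odd => //; apply: Lser_Mser; apply: Lser_comm.
move: hb hsq; rewrite !(phiB, phiD, phiM) -hq => hb hsq.
by apply: (mem_eq (memD (memD (memB hb hsq) (hd c a)) (hd a c))); ncring.
Qed.

Lemma J_comm3_mul a c : J ({[phi c, {[phi a, q]}]} * phi l).
Proof.
apply: (J_unit _ _ hs).
have L3 (x : A) : Mser 3 {[c, {[a, x]}]}.
  by apply: Lser_Mser; do 2!apply: Lser_comm.
have hb := J_mul_rmor 1 _ (Mser3_mul _ _ _ _ (L3 b) (Lser_Mser _ _ _ hl)).
have hsq := J_Mser3_mul _ (L3 s).
move: hb hsq; rewrite !(phiB, phiD, phiM) -hq => hb hsq.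
apply: (mem_eq (memB (memB hb hsq) (J_comm_comm_sym_mul a c))); ncring.
Qed.

(** Leibniz gives four terms: [[a, [c, q]] l], the symmetric pair [[c, q] [a, l] + [a, q] [c, l]],
    and [q [a, [c, l]]]. *)
Lemma J_comm_comm_mul a c : J {[phi a, {[phi c, q * phi l]}]}.
Proof.
have h1 := J_comm3_mul c a.
have h2 := J_comm_mul_comm_sym c a.
have h3 : J (q * phi {[a, {[c, l]}]}).
  by apply: J_mul_rmor; apply: Lser_Mser; do 2!apply: Lser_comm.
move: h3; rewrite !(phiB, phiM) => h3.
by apply: (mem_eq (memD (memD h1 h2) h3)); ncring.
Qed.

End FixedElements.

Lemma J_comm_comm_SinvM a c v : SinvM S phi n.*2.+1 v ->
  J {[phi a, {[phi c, v]}]}.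
Proof.
apply: (cspan_linear _ _ _ _ (fun v => {[phi a, {[phi c, v]}]})); first by lin.
move=> _ [s [m [hs [hm ->]]]]; move: m hm.
apply: (Mser_elim _ _ _ _ (fun m => {[phi a, {[phi c, (phi s)^-1 * phi m]}]})).
  by lin.
move=> b l hl; rewrite phiM (mulrA (phi s)^-1).
apply: (J_comm_comm_mul _ _ _ _ hs hl).
by rewrite mulVKr //; case: hQ => /(_ s hs).
Qed.

End OreLocalization.

Theorem theorem3p7
  (A : algType CC) (hfg : fin_gen A)
  (hnil : exists N : nat, forall x : A, Mser N x -> x = 0)
  (Abar : pzRingType) (pi : {rmorphism A -> Abar})
  (pi_surj : forall y : Abar, exists x : A, pi x = y)
  (pi_ker : forall x : A, pi x = 0 <-> Mser 2 x)
  (Sbar : Abar -> Prop)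
  (Sbar1 : Sbar 1)
  (SbarM : forall u v, Sbar u -> Sbar v -> Sbar (u * v))
  (Sbar_nozd : forall u, Sbar u -> forall y : Abar,
       (u * y = 0 -> y = 0) /\ (y * u = 0 -> y = 0))
  (Q : unitAlgType CC) (phi : {lrmorphism A -> Q})
  (hQ : left_ring_of_fractions (fun s => Sbar (pi s)) phi)
  (k : nat) (hk : odd k) :
  forall x : Q,
    cspan (fun y => exists (a b : A) (v : Q),
              SinvM (fun s => Sbar (pi s)) phi k v /\
              y = phi a * (phi b * v - v * phi b) - (phi b * v - v * phi b) * phi a) x ->
    exists u w : Q,
      SinvM (fun s => Sbar (pi s)) phi (k + 2) u /\ Mser (k + 3) w /\ x = u + w.

Proof.
have [n ->] : exists n, k = n.*2.+1.
  by exists k./2; rewrite -[LHS]odd_double_half hk.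
rewrite addn2 addn3.
apply: (cspan_linear _ _ _ _ (fun x => x) (J_subspace _ _ _ phi n)) => //.
by move=> _ [a [b [v [hv ->]]]]; apply: J_comm_comm_SinvM hv.
Qed.
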